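(* Every topological ring $R$ that has a neighborhood base at zero consisting of open ideals is Hirsch.
   Context: A topological ring is an Abelian topological group $R$ (written additively, identity $0$) endowed with a continuous associative binary operation $\cdot:R\times R\to R$ which is distributive: $x(y+z)=xy+xz$ and $(x+y)z=xz+yz$ for all $x,y,z\in R$ (no unit and no commutativity of multiplication is assumed). An ideal in $R$ is a two-sided ideal of $R$, i.e. an additive subgroup $I$ with $IR\cup RI\subseteq I$. A series $\sum_{n\in\omega}x_n$ in an Abelian topological group $G$ unconditionally converges to $x\in G$ if for any neighborhood $U$ of $0$ there is a finite set $F\subset\omega$ such that $\sum_{i\in J}x_i\in x+U$ for any finite set $J\subset\omega$ containing $F$; it is unconditionally convergent if it unconditionally converges to some $x\in G$. Here $\omega=\{0,1,2,\dots\}$. A topological ring $R$ is Hirsch if for any unconditionally convergent series $\sum_{n\in\omega}x_n$ in $R$ and any neighborhood $U\subseteq R$ of $0$ there exists a neighborhood $V\subseteq R$ of $0$ such that $\sum_{n\in F}a_nx_n\in U$ for any finite set $F\subset\omega$ and any sequence $(a_n)_{n\in F}\in V^F$. *)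

(* Defs.v *)
From HB Require Import structures.
From mathcomp Require Import all_boot all_algebra finmap.
From mathcomp Require Import classical_sets topology tvs.

Set Implicit Arguments.
Unset Strict Implicit.
Unset Printing Implicit Defensive.

Import GRing.Theory.

Local Open Scope classical_set_scope.
Local Open Scope ring_scope.

(* MathComp's ring structures all have a unit, so the multiplication of a
   possibly non-unital, non-commutative topological ring is put directly on top
   of a topological abelian group. No separation axiom is assumed. *)
HB.mixin Record TopologicalZmodule_isTopologicalRng R
    of TopologicalZmodule R := {
  rng_mul : R -> R -> R ;
  rng_mulA : associative rng_mul ;
  rng_mulDl : left_distributive rng_mul +%R ;
  rng_mulDr : right_distributive rng_mul +%R ;
  rng_mul_continuous : continuous (fun p : R * R => rng_mul p.1 p.2)
}.

#[short(type="topologicalRngType")]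
HB.structure Definition TopologicalRng :=
  {R of TopologicalZmodule R & TopologicalZmodule_isTopologicalRng R}.

Record two_sided_ideal (R : topologicalRngType) (I : set R) : Prop :=
  TwoSidedIdeal {
    ideal0 : I 0 ;
    idealD : forall x y : R, I x -> I y -> I (x + y) ;
    idealN : forall x : R, I x -> I (- x) ;
    ideal_mulr : forall x r : R, I x -> I (rng_mul x r) ;
    ideal_mull : forall r x : R, I x -> I (rng_mul r x)
  }.

Definition nbhs_base (T : topologicalType) (p : T) (B : set (set T)) : Prop :=
  B `<=` nbhs p /\ forall U : set T, nbhs p U -> exists2 V, B V & V `<=` U.

Definition unconditionally_converges (G : topologicalZmodType)
    (x : nat -> G) (l : G) : Prop :=
  forall U : set G, nbhs (0 : G) U ->
    exists F : {fset nat}, forall J : {fset nat}, (F `<=` J)%fset ->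
      [set l + u | u in U] (\sum_(i <- J) x i).

Definition unconditionally_convergent (G : topologicalZmodType)
    (x : nat -> G) : Prop :=
  exists l : G, unconditionally_converges x l.

(* Only the values of [a] on [F] matter, so a finite sequence indexed by [F]
   is represented by a function on all of [nat]. *)
Definition hirsch (R : topologicalRngType) : Prop :=
  forall x : nat -> R, unconditionally_convergent x ->
  forall U : set R, nbhs (0 : R) U ->
  exists2 V : set R, nbhs (0 : R) V &
    forall (F : {fset nat}) (a : nat -> R),
      (forall n, n \in F -> V (a n)) ->
      U (\sum_(n <- F) rng_mul (a n) (x n)).

(* Main.v *)
(* An open ideal I contained in U serves as V itself: every a x with a in I
   lies in I, and I is closed under finite sums. *)
Require Import Defs.
From mathcomp Require Import all_boot all_algebra.
From mathcomp Require Import classical_sets topology tvs.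

Local Open Scope classical_set_scope.
Local Open Scope ring_scope.

(** An ideal inside [U] absorbs products and is closed under addition, so coefficients drawn from it
    keep every finite combination in it, with no loss as [F] grows. *)

Theorem proposition3p1 (R : topologicalRngType)
  (hbase : exists2 B : set (set R), nbhs_base (0 : R) B &
             forall I : set R, B I -> open I /\ two_sided_ideal I) :
  hirsch R.
Proof.
move=> x _ U U0; have [B [Bnbhs Bbase] Bideal] := hbase.
have [I BI IU] := Bbase U U0; have [_ idI] := Bideal I BI.
exists I; first exact: Bnbhs.
(* [big_seq] records [n \in F] as a condition on the summands; [aI] needs it for each term. *)
move=> F a aI; apply: IU; rewrite big_seq; apply: (big_ind I).
- exact: ideal0 idI.
- by move=> y z; apply: (idealD idI).
(* The left factor [a n] lies in [I], so absorption on the right by [x n] applies. *)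
- by move=> n nF; apply: (ideal_mulr idI); apply: aI.
Qed.
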